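(* Let $s\in(0,1)$, let $\Omega\subset\mathbb{R}^N$ be a bounded strictly convex domain of class $C^2$, and let $f\in C(\overline\Omega)$ and $g\in C(\overline{\mathbb{R}^N\setminus\Omega})$ be bounded. Let $u,v\colon\mathbb{R}^N\to\mathbb{R}$ be, respectively, a viscosity subsolution and a viscosity supersolution (in the sense described in the context) of \[ \begin{cases} \displaystyle \Lambda_1^s u(x)\coloneqq \inf\left\{\int_{\mathbb{R}}\frac{u(x+tz)-u(x)}{|t|^{1+2s}}\,dt\colon z\in\mathbb{S}^{N-1}\right\}=f(x), & x\in\Omega,\\[6pt] u(x)=g(x), & x\in\mathbb{R}^N\setminus\Omega. \end{cases} \] Then (i) $u\le g$ on $\partial\Omega$; and (ii) $v\ge g$ on $\partial\Omega$.
   Context: Integrals are principal value integrals; $\mathbb{S}^{N-1}$ is the unit sphere. For $u\colon\overline\Omega\to\mathbb{R}$ let the upper $g$-extension be $u^g=u$ in $\Omega$, $u^g=g$ in $\mathbb{R}^N\setminus\overline\Omega$, $u^g=\max\{u,g\}$ on $\partial\Omega$; the lower $g$-extension $u_g$ uses $\min$ instead. For $\delta>0$, $z\in\mathbb{S}^{N-1}$, a $C^2$ function $\phi$ and a function $w$, set $E_{z,\delta}(w,\phi,x)\coloneqq\int_{-\delta}^{\delta}\frac{\phi(x+tz)-\phi(x)}{|t|^{1+2s}}dt+\int_{\mathbb{R}\setminus(-\delta,\delta)}\frac{w(x+tz)-u(x)}{|t|^{1+2s}}dt-f(x)$ and $E_\delta(w,\phi,x)\coloneqq-\inf_{z\in\mathbb{S}^{N-1}}E_{z,\delta}(w,\phi,x)$.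 A bounded upper semicontinuous $u\colon\mathbb{R}^N\to\mathbb{R}$ is a viscosity subsolution if $u\le g$ in $\mathbb{R}^N\setminus\overline\Omega$ and for every $\delta>0$ and $\phi\in C^2(\mathbb{R}^N)$ such that $x_0$ is a maximum point of $u-\phi$ in $B_\delta(x_0)$: $E_\delta(u^g,\phi,x_0)\le0$ if $x_0\in\Omega$, and $\min\{E_\delta(u^g,\phi,x_0),u(x_0)-g(x_0)\}\le 0$ if $x_0\in\partial\Omega$ (if $u$ is not upper semicontinuous, this is required of its upper semicontinuous envelope). Viscosity supersolutions are defined analogously, with lower semicontinuity, $u_g$, minimum points and reversed inequalities (with $\max$ instead of $\min$ on $\partial\Omega$). *)

(* Defs.v *)
From HB Require Import structures.
From mathcomp Require Import all_boot all_order all_algebra.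
From mathcomp Require Import all_classical all_reals all_analysis.
Set Implicit Arguments. Unset Strict Implicit. Unset Printing Implicit Defensive.
Import Order.TTheory GRing.Theory Num.Theory.
Import numFieldNormedType.Exports.
Local Open Scope classical_set_scope.
Local Open Scope ring_scope.

Section Defs.
Variables (R : realType) (N : nat).
Notation V := 'rV[R]_N.

Definition edot (x y : V) : R := \sum_(i < N) x ord0 i * y ord0 i.
Definition enorm (x : V) : R := Num.sqrt (edot x x).
Definition sphere : set V := [set z | enorm z = 1].
Definition eball (x : V) (r : R) : set V := [set y | enorm (y - x) < r].
Definition evec (i : 'I_N) : V := delta_mx ord0 i.

Definition C2 (phi : V -> R) : Prop :=
  continuous phi /\
  forall i j : 'I_N,
    (forall x, derivable phi x (evec i)) /\
    continuous (fun x => derive phi x (evec i)) /\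
    (forall x, derivable (fun y => derive phi y (evec i)) x (evec j)) /\
    continuous (fun x => derive (fun y => derive phi y (evec i)) x (evec j)).

Definition boundary (Om : set V) : set V := closure Om `\` Om.

Definition bounded_domain (Om : set V) : Prop :=
  Om !=set0 /\ open Om /\ connected Om /\
  exists M : R, forall x, Om x -> enorm x <= M.

Definition strictly_convex (Om : set V) : Prop :=
  forall x y, closure Om x -> closure Om y -> x != y ->
  forall l : R, 0 < l < 1 -> Om ((1 - l) *: x + l *: y).

Definition C2_domain (Om : set V) : Prop :=
  forall p, boundary Om p ->
  exists r : R, 0 < r /\ exists rho : V -> R,
    C2 rho /\ rho p = 0 /\ (exists i, derive rho p (evec i) != 0) /\
    forall x, eball p r x -> (Om x <-> rho x < 0).

Definition bounded_on (h : V -> R) (A : set V) : Prop :=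
  exists M : R, forall x, A x -> `|h x| <= M.

Definition usc_env (u : V -> R) (x : V) : R :=
  inf [set sup (u @` eball x r) | r in [set r : R | 0 < r]].
Definition lsc_env (u : V -> R) (x : V) : R :=
  sup [set inf (u @` eball x r) | r in [set r : R | 0 < r]].

Definition ext_up (Om : set V) (u g : V -> R) (x : V) : R :=
  if x \in Om then u x else if x \in closure Om then Num.max (u x) (g x) else g x.
Definition ext_low (Om : set V) (u g : V -> R) (x : V) : R :=
  if x \in Om then u x else if x \in closure Om then Num.min (u x) (g x) else g x.

Variable s : R.
Definition kern (t : R) : R := (`|t| `^ (1 + 2 * s))^-1.

(* E_{z,delta}(w,phi,x); ux is the value u(x). The first integral is the
   principal value lim_{eps->0+} int_{eps<|t|<delta}. *)
Definition Ez (f : V -> R) (delta : R) (z : V) (w phi : V -> R) (ux : R)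
    (x : V) : \bar R :=
  (lim ((fun eps : R =>
     \int[lebesgue_measure]_(t in [set t : R | (eps < `|t| < delta)%R])
        ((phi (x + t *: z) - phi x) * kern t)%:E) @ 0^'+)
   + \int[lebesgue_measure]_(t in [set t : R | (delta <= `|t|)%R])
        ((w (x + t *: z) - ux) * kern t)%:E
   - (f x)%:E)%E.

Definition Ed (f : V -> R) (delta : R) (w phi : V -> R) (ux : R) (x : V)
    : \bar R :=
  (- ereal_inf [set Ez f delta z w phi ux x | z in sphere])%E.

Definition visc_sub (Om : set V) (f g u : V -> R) : Prop :=
  bounded_on u setT /\
  let U := usc_env u in
  (forall x, ~ closure Om x -> U x <= g x) /\
  forall (delta : R) (phi : V -> R) (x0 : V), 0 < delta -> C2 phi ->
    (forall x, eball x0 delta x -> U x - phi x <= U x0 - phi x0) ->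
    (Om x0 -> (Ed f delta (ext_up Om U g) phi (U x0) x0 <= 0)%E) /\
    (boundary Om x0 ->
       (Order.min (Ed f delta (ext_up Om U g) phi (U x0) x0)
                  (U x0 - g x0)%:E <= 0)%E).

Definition visc_super (Om : set V) (f g v : V -> R) : Prop :=
  bounded_on v setT /\
  let L := lsc_env v in
  (forall x, ~ closure Om x -> g x <= L x) /\
  forall (delta : R) (phi : V -> R) (x0 : V), 0 < delta -> C2 phi ->
    (forall x, eball x0 delta x -> L x0 - phi x0 <= L x - phi x) ->
    (Om x0 -> (0 <= Ed f delta (ext_low Om L g) phi (L x0) x0)%E) /\
    (boundary Om x0 ->
       (0 <= Order.max (Ed f delta (ext_low Om L g) phi (L x0) x0)
                       (L x0 - g x0)%:E)%E).

End Defs.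

(* Main.v *)
Require Import Defs.
From HB Require Import structures.
From mathcomp Require Import all_boot all_order all_algebra.
From mathcomp Require Import all_classical all_reals all_analysis.
From mathcomp Require Import measurable_realfun ring lra.
Import Order.TTheory GRing.Theory Num.Theory.
Import numFieldNormedType.Exports.
Local Open Scope classical_set_scope.
Local Open Scope ring_scope.

(** Both parts come from one barrier argument with an affine test function.
    For the supersolution, let [L] be the lower semicontinuous envelope of [v]
    and suppose [L x0 < g x0] at a boundary point [x0] with outer normal [nu].
    For [B] large, minimise [L - B nu . y] over the closure of [Om]: the minimum
    point [xb] lies in a thin cap at [x0], and by strict convexity caps shrink to
    [x0], so [xb] is close to [x0]. Since [L >= g > L xb] outside the closure
    near [x0], the affine function also touches [L] at [xb] from outside on a
    small enough ball.

    The principal value of an affine function is [0]. Along a direction [z], let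
    [l] be the exit time of the shorter half of the chord through [xb]. For
    [|t| < l] the point [xb + t z] is in [Om] and minimality bounds the increment
    of [L] below by an odd function of [t], which contributes nothing. For
    [|t| > l] one of the two half lines is outside the closure, where the
    increment is at least [3 c], while on the other it is at least [- c] by
    semicontinuity: up to an odd function this is a gain of [c]. As [l <= rho] for
    all [z], where [rho] is the size of the cap, the gain dominates
    [c rho (2 rho)^(-1-2s)], which is arbitrarily large, so [E_z] is bounded below
    by a positive constant uniformly in [z], against the supersolution property.
    Negating all functions gives the statement for subsolutions. *)

(** * Integration against the kernel *)

(* The functions integrated in [Ez] are restrictions of arbitrary extensions to
   lines, so monotonicity is needed without measurability. It holds because the
   integral is built from suprema over the simple functions below [f^\+], [f^\-]. *)
Section monotone.
Import HBNNSimple.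

Lemma le_integral_nonmeasurable d (T : measurableType d) (R : realType)
    (mu : {measure set T -> \bar R}) (D : set T) (f g : T -> \bar R) :
  (forall x, D x -> (f x <= g x)%E) ->
  (\int[mu]_(x in D) f x <= \int[mu]_(x in D) g x)%E.
Proof.
move=> fg; have fgD x : ((f \_ D) x <= (g \_ D) x)%E.
  by rewrite /patch; case: ifPn => // /set_mem /fg.
have le_sup h1 h2 : (forall x, (h1 x <= h2 x)%E) ->
    (ereal_sup [set sintegral mu h | h in
       [set h : {nnsfun T >-> R} | forall x, ((h x)%:E <= h1 x)%E]] <=
     ereal_sup [set sintegral mu h | h in
       [set h : {nnsfun T >-> R} | forall x, ((h x)%:E <= h2 x)%E]])%E.
  move=> h12; apply: le_ereal_sup => _ [h hh1 <-]; exists h => // x.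
  exact: le_trans (hh1 x) (h12 x).
rewrite /integral; apply: leeB; apply: le_sup => x.
  by apply: (@funepos_le _ _ setT) (in_setT x) => y _; exact: fgD.
by apply: (@funeneg_le _ _ setT) (in_setT x) => y _; exact: fgD.
Qed.

End monotone.

(** * Reflection of integrals and odd integrands *)

Section odd.
Variable R : realType.
Notation mu := (@lebesgue_measure R).

Lemma integral_reflect (D : set R) (f : R -> \bar R) : measurable D ->
  measurable_fun [set: R] f -> mu.-integrable (-%R @^-1` D) (f \o -%R) ->
  (\int[mu]_(t in D) f t = \int[mu]_(t in -%R @^-1` D) f (- t)%R)%E.
Proof.
move=> mD mf fi.
have mN : measurable_fun [set: measurableTypeR R]
    (-%R : measurableTypeR R -> measurableTypeR R).
  exact: oppr_measurable.
rewrite -(@integral_pushforward _ _ _ _ _ _ mN mu D f)//.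
by apply: eq_measure_integral => A mA _; exact/esym/lebesgue_measureN.
Qed.

(** Reflection turns the integral into its own opposite. Integrability makes it finite, and a real
    number equal to its opposite is [0]. *)
Lemma integral_odd (D : set R) (f : R -> R) : measurable D ->
  (forall t, D t -> D (- t)) -> measurable_fun [set: R] f ->
  (forall t, f (- t) = - f t) -> mu.-integrable D (EFin \o f) ->
  (\int[mu]_(t in D) (f t)%:E = 0)%E.
Proof.
move=> mD DN mf fN fi.
have DE : -%R @^-1` D = D.
  apply/seteqP; split => t /=; last exact: DN.
  by move=> /DN; rewrite opprK.
have fNE : (EFin \o f) \o -%R = (-%E \o (EFin \o f))%E.
  by apply/funext => t /=; rewrite fN.
have mEf : measurable_fun [set: R] (EFin \o f) by exact/measurable_EFinP.
have := @integral_reflect D (EFin \o f) mD mEf.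
rewrite DE fNE => /(_ (integrableN fi)).
have -> : (\int[mu]_(t in D) (EFin \o f) (- t)%R)%E =
          (\int[mu]_(t in D) ((-1)%:E * (EFin \o f) t))%E.
  by apply: eq_integral => t _ /=; rewrite fN -EFinM mulN1r.
rewrite integralZl//.
have : integral mu D (EFin \o f) \is a fin_num by exact: integrable_fin_num.
rewrite -[X in X = 0%E]/(integral mu D (EFin \o f)).
case: (integral mu D (EFin \o f)) => // a _.
by rewrite -EFinM => -[] aE; congr EFin; lra.
Qed.
End odd.

(** * The kernel and its integrability away from the origin *)

Section kernel.
Variables (R : realType) (s : R).
Notation mu := (@lebesgue_measure R).
Notation k := (kern s).

Lemma kern_ge0 t : 0 <= k t.
Proof. by rewrite /kern invr_ge0 powR_ge0. Qed.

Lemma kernN t : k (- t) = k t.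
Proof. by rewrite /kern normrN. Qed.

Lemma measurable_kern : measurable_fun [set: R] (k : R -> R).
Proof.
have -> : k = (powR (R:=R))^~ (- (1 + 2 * s)) \o Num.Def.normr.
  by apply/funext => t; rewrite /kern /= powRN.
by apply: measurableT_comp => //; exact: measurable_powR.
Qed.

Lemma kern_le (a b : R) : 0 < s -> 0 < a -> a <= b -> k b <= k a.
Proof.
move=> s0 a0 ab; have b0 : 0 < b by lra.
rewrite /kern !gtr0_norm// lef_pV2 ?posrE ?powR_gt0//.
have p0 : 0 <= 1 + 2 * s by lra.
by apply: ge0_ler_powR => //; rewrite nnegrE; exact: ltW.
Qed.

Lemma measurable_norm_preimage (A : set R) : measurable A ->
  measurable [set t : R | A `|t|].
Proof.
move=> mA; have := @normr_measurable R setT measurableT A mA.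
by rewrite setTI.
Qed.

Lemma cvg_powRN (p : R) : 0 < p -> x `^ (- p) @[x --> +oo] --> (0 : R).
Proof.
move=> p0; apply/cvgrPdist_lt => e e0; near=> x.
have x0 : 0 < x by near: x; apply: nbhs_pinfty_gt; rewrite num_real.
rewrite sub0r normrN gtr0_norm ?powR_gt0// powRN.
rewrite invf_plt ?posrE ?powR_gt0//.
have -> : e^-1 = ((e^-1) `^ (p^-1)) `^ p.
  by rewrite -powRrM mulVf ?gt_eqF// powRr1// invr_ge0 ltW.
apply: gt0_ltr_powR => //; rewrite ?nnegrE ?powR_ge0 ?(ltW x0)//.
Unshelve. all: end_near. Qed.

Lemma integral_kern_right (a : R) : 0 < s -> 0 < a ->
  (\int[mu]_(t in `[a, +oo[) (k t)%:E < +oo)%E.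
Proof.
move=> s0 a0.
(* An antiderivative of the kernel on the positive half line which tends to [0] at infinity because
   [s > 0]; the improper integral is then [- F a]. *)
pose F (t : R) : R := - (2 * s)^-1 * t `^ (- (2 * s)).
have s2 : 0 < 2 * s by lra.
have dF (x : R) : 0 < x -> is_derive x 1 F (x `^ (- (1 + 2 * s))).
  move=> x0; have -> : x `^ (- (1 + 2 * s)) =
      - (2 * s)^-1 *: (- (2 * s) * x `^ (- (2 * s) - 1)).
    rewrite /GRing.scale /= mulrA mulrNN mulVf ?gt_eqF// mul1r.
    by congr powR; ring.
  have := is_derive1_powR (- (2 * s)) x0 => dP.
  exact: is_deriveZ.
have cvgF : F x @[x --> +oo] --> (0 : R).
  have := cvgM (cvg_cst (- (2 * s)^-1)) (cvg_powRN (2 * s) s2).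
  by rewrite mulr0; apply.
have cF (x : R) : 0 < x -> {for x, continuous F}.
  move=> x0; apply: differentiable_continuous; apply/derivable1_diffP.
  by have [] := dF x x0.
have cP (x : R) : 0 < x -> {for x, continuous (fun t : R => t `^ (- (1 + 2 * s)))}.
  move=> x0; apply: differentiable_continuous; apply/derivable1_diffP.
  by apply: derivable_powR; rewrite in_itv /= x0.
have -> : (\int[mu]_(t in `[a, +oo[) (k t)%:E)%E =
    (\int[mu]_(t in `[a, +oo[) (t `^ (- (1 + 2 * s)))%:E)%E.
  apply: eq_integral => t /[!inE] /=; rewrite in_itv /= andbT => at_.
  by rewrite /kern powRN ger0_norm//; lra.
rewrite (@ge0_continuous_FTC2y _ _ F a 0)//.
- by rewrite -EFinB ltry.
- by move=> x _; rewrite powR_ge0.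
- apply/continuous_within_itvcyP; split.
    by move=> x; rewrite in_itv /= andbT => ax; apply: cP; lra.
  by apply: cvg_at_right_filter; exact: cP.
- by move=> x ax; have [] := dF x (lt_trans a0 ax).
- by apply: cvg_at_right_filter; exact: cF.
- move=> x; rewrite in_itv /= andbT => ax; rewrite derive1E.
  by have [_ ->] := dF x (lt_trans a0 ax).
Qed.

Lemma kern_integrable (a : R) : 0 < s -> 0 < a ->
  mu.-integrable [set t | a <= `|t|] (EFin \o k).
Proof.
move=> s0 a0.
have DE : [set t : R | a <= `|t|] = `[a, +oo[ `|` `]-oo, - a].
  apply/seteqP; split => t /=; rewrite !in_itv /= andbT ler_normr.
    by case/orP => h; [left|right]; lra.
  by case => h; apply/orP; [left|right]; lra.
have mk D : measurable_fun D (EFin \o k).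
  apply: measurable_funTS; apply/measurable_EFinP; exact: measurable_kern.
apply/integrableP; split; first exact: mk.
under eq_integral do rewrite /= ger0_norm ?kern_ge0//.
rewrite DE ge0_integral_setU//; last 3 first.
- exact: mk.
- by move=> t _; rewrite lee_fin kern_ge0.
- rewrite disj_set2E; apply/eqP/seteqP; split => // t [] /=.
  by rewrite !in_itv /= andbT; lra.
rewrite lte_add_pinfty ?integral_kern_right//.
(* The left half line is reflected onto the right one, where the integral is already known to be
   finite. *)
have NE : `]-oo, - a]%classic = -%R @^-1` `[a, +oo[%classic.
  by rewrite opp_preimage_itvbndy.
rewrite NE.
have -> : (\int[mu]_(t in -%R @^-1` `[a, +oo[) (k t)%:E =
   \int[mu]_(t in -%R @^-1` `[a, +oo[) ((EFin \o k) \o -%R) t)%E.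
  by apply: eq_integral => t _ /=; rewrite kernN.
have mN : measurable_fun [set: measurableTypeR R]
    (-%R : measurableTypeR R -> measurableTypeR R).
  exact: oppr_measurable.
rewrite -(@ge0_integral_pushforward _ _ _ _ _ _ mN mu _ (EFin \o k))//; last 2 first.
  exact: mk.
  by move=> t _; rewrite lee_fin kern_ge0.
rewrite [X in (X < _)%E](_ : _ = integral mu `[a, +oo[ (EFin \o k)).
  exact: integral_kern_right.
by apply: eq_measure_integral => A mA _; exact: lebesgue_measureN.
Qed.

End kernel.

(** * Lower bounds for tail integrals *)

Section tail.
Variables (R : realType) (s : R).
Notation mu := (@lebesgue_measure R).
Notation k := (kern s).

Lemma measurable_norm_ge (a : R) : measurable [set t : R | a <= `|t|].
Proof.
have -> : [set t : R | a <= `|t|] = [set t : R | `[a, +oo[%classic `|t|].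
  by apply/seteqP; split => t /=; rewrite in_itv /= andbT.
by apply: measurable_norm_preimage; exact: measurable_itv.
Qed.

Lemma integrable_mul_kern (a P : R) (h : R -> R) : 0 < s -> 0 < a ->
  measurable_fun [set: R] h -> (forall t, `|h t| <= P) ->
  mu.-integrable [set t | a <= `|t|] (fun t => (h t * k t)%:E).
Proof.
move=> s0 a0 mh hP.
apply: (@le_integrable _ _ _ mu _ (measurable_norm_ge a) _
  (fun t => P%:E * (k t)%:E)%E).
- apply: measurable_funTS; apply/measurable_EFinP; apply: measurable_funM => //.
  exact: measurable_kern.
- move=> t _; rewrite -EFinM lee_fin.
  rewrite !normrM ler_wpM2r// (le_trans (hP t))// ler_norm//.
- by apply: integrableZl; [exact: measurable_norm_ge|exact: kern_integrable].
Qed.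

(** Taken as a real number so that it can enter the choice of constants; for [0 < s] and [0 < r] the
    integral is finite. *)
Definition tailmass (r : R) : R :=
  fine (\int[mu]_(t in [set t | (r <= `|t|)%R]) (k t)%:E)%E.

Lemma tailmassE (r : R) : 0 < s -> 0 < r ->
  (\int[mu]_(t in [set t | (r <= `|t|)%R]) (k t)%:E = (tailmass r)%:E)%E.
Proof.
move=> s0 r0; rewrite /tailmass fineK//; apply: integrable_fin_num => //.
  exact: measurable_norm_ge.
exact: kern_integrable.
Qed.

Lemma integral_indic_tail (d r : R) : 0 < s -> 0 < d -> d <= r ->
  (\int[mu]_(t in [set t | (d <= `|t|)%R])
     (\1_[set t : R | (r <= `|t|)%R] t * k t)%:E = (tailmass r)%:E)%E.
Proof.
move=> s0 d0 dr; rewrite -tailmassE//; last lra.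
rewrite [in RHS](_ : [set t : R | r <= `|t|] =
    [set t | d <= `|t|] `&` [set t : R | r <= `|t|]); last first.
  by apply/seteqP; split => t /=; [move=> ?; split|case]; lra.
rewrite integral_mkcondr; apply: eq_integral => t _.
by rewrite /patch indicE; case: ifPn => _; rewrite ?mul1r ?mul0r.
Qed.

(** It is enough to keep the right half of the shell, an interval of length [rho] on which the
    decreasing kernel is at least its value at [2 * rho]. *)
Lemma integral_kern_shell_ge (d rho : R) : 0 < s -> 0 < d -> d <= rho ->
  ((rho * k (2 * rho))%:E <=
   \int[mu]_(t in [set t | (d <= `|t|)%R])
     (\1_[set t : R | (rho < `|t| < 2 * rho)%R] t * k t)%:E)%E.
Proof.
move=> s0 d0 dr; have r0 : 0 < rho by lra.
have mI : measurable (`]rho, 2 * rho[%classic : set R) by exact: measurable_itv.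
apply: (@le_trans _ _ (\int[mu]_(t in [set t | (d <= `|t|)%R])
     (k (2 * rho) * \1_(`]rho, 2 * rho[%classic : set R) t)%:E)%E); last first.
  apply: le_integral_nonmeasurable => t /= dt; rewrite lee_fin mulrC !indicE.
  case: (boolP (t \in _)) => [|_]; last by rewrite mul0r mulr_ge0 ?kern_ge0.
  rewrite inE /= in_itv /= => /andP[t1 t2].
  rewrite mem_set /=; last by rewrite gtr0_norm; lra.
  by rewrite !mul1r; apply: kern_le => //; lra.
under eq_integral do rewrite EFinM.
rewrite integralZl//; last 2 first.
- exact: measurable_norm_ge.
- apply: (@integrableS _ _ _ mu setT) => //; first exact: measurable_norm_ge.
  exact: integrable_indic_itv.
rewrite integral_indic//; last exact: measurable_norm_ge.
rewrite (_ : _ `&` _ = `]rho, 2 * rho[%classic); last first.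
  apply/seteqP; split => t /=; rewrite in_itv /=; first by case.
  by move=> /andP[t1 t2]; split; [lra|rewrite gtr0_norm; lra].
rewrite /= lebesgue_measure_itv /= lte_fin.
have -> : rho < 2 * rho by lra.
by rewrite -EFinB -EFinM lee_fin; have := kern_ge0 _ s (2 * rho); nra.
Qed.

(** The exceptional points lie in the null set consisting of [l] and [- l]. *)
Lemma eq_integral_norm_neq (d l : R) (h h' : R -> \bar R) : 
  mu.-integrable [set t : R | d <= `|t|] h ->
  mu.-integrable [set t : R | d <= `|t|] h' ->
  (forall t, `|t| != l -> h t = h' t) ->
  (\int[mu]_(t in [set t | (d <= `|t|)%R]) h t =
   \int[mu]_(t in [set t | (d <= `|t|)%R]) h' t)%E.
Proof.
move=> hi hi' hh.
have mN : measurable [set l; - l] by apply: measurableU; exact: measurable_set1.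
have N0 : mu [set l; - l] = 0%E.
  apply/eqP; rewrite eq_le measure_ge0 andbT.
  by rewrite (le_trans (measureU2 _ _ _))//= !lebesgue_measure_set1 adde0.
have mD := measurable_norm_ge d.
rewrite (@negligible_integral _ _ _ mu _ _ _ mN mD hi N0).
rewrite (@negligible_integral _ _ _ mu _ _ _ mN mD hi' N0).
apply: eq_integral => t /[!inE] -[_ tN]; apply: hh.
apply/eqP => tl; apply: tN; rewrite -tl.
by case: (ger0P t) => _; [left|right]; rewrite ?opprK.
Qed.

(* [b] is the lower bound for the increment along a line through the touching
   point. At the exit times [|t| = l] only the crude bound [- M] is available;
   they form a null set. *)
Lemma tail_integral_ge (d rho r l c M P : R) (o : R -> R) :
  0 < s -> 0 < d -> d <= rho -> d <= r -> 0 <= c -> 0 <= M ->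
  measurable_fun [set: R] o -> (forall t, o (- t) = - o t) ->
  (forall t, `|o t| <= P) ->
  let b t := o t + c * \1_[set t : R | (rho < `|t| < 2 * rho)%R] t
             - M * \1_[set t : R | (r <= `|t|)%R] t
             - M * \1_[set t : R | `|t| = l] t in
  mu.-integrable [set t | d <= `|t|] (fun t => (b t * k t)%:E) /\
  ((c * (rho * k (2 * rho)) - M * tailmass r)%:E <=
   \int[mu]_(t in [set t | (d <= `|t|)%R]) (b t * k t)%:E)%E.
Proof.
move=> s0 d0 drho dr c0 M0 mo oN oP.
set A := [set t : R | (rho < `|t| < 2 * rho)%R].
set B := [set t : R | (r <= `|t|)%R].
set N := [set t : R | `|t| = l].
move=> b; pose D := [set t : R | d <= `|t|].
have mA : measurable A.
  have -> : A = [set t : R | `]rho, 2 * rho[%classic `|t|].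
    by apply/seteqP; split => t /=; rewrite in_itv.
  by apply: measurable_norm_preimage; exact: measurable_itv.
have mB : measurable B by exact: measurable_norm_ge.
have mN : measurable N.
  have -> : N = [set t : R | [set l] `|t|] by [].
  by apply: measurable_norm_preimage; exact: measurable_set1.
have i1 (E : set R) : measurable E ->
    mu.-integrable D (fun t => (\1_E t * k t)%:E).
  move=> mE; apply: (integrable_mul_kern d 1) => // t.
  by rewrite indicE; case: (_ \in _); rewrite ?normr1 ?normr0.
have io : mu.-integrable D (fun t => (o t * k t)%:E).
  exact: (integrable_mul_kern d P).
have iZ (e : R) (E : set R) : measurable E ->
    mu.-integrable D (fun t => (e * (\1_E t * k t))%:E).
  move=> mE.
  apply: (@integrableZl _ _ _ mu D _ e (fun t => (\1_E t * k t)%:E)); last exact: i1.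
  exact: measurable_norm_ge.
pose b' t := (o t * k t + c * (\1_A t * k t)) - M * (\1_B t * k t).
have ioc : mu.-integrable D (fun t => (o t * k t + c * (\1_A t * k t))%:E).
  exact: (@integrableD _ _ _ mu D (measurable_norm_ge d) _ _ io (iZ c A mA)).
have ib' : mu.-integrable D (EFin \o b').
  exact: (@integrableB _ _ _ mu D (measurable_norm_ge d) _ _ ioc (iZ M B mB)).
have ib : mu.-integrable D (fun t => (b t * k t)%:E).
  have -> : (fun t => (b t * k t)%:E) =
     ((EFin \o b') \- (fun t => (M * (\1_N t * k t))%:E))%E.
    by apply/funext => t /=; rewrite -EFinB; congr EFin; rewrite /b /b'; ring.
  apply: integrableB => //; last exact: iZ.
  exact: measurable_norm_ge.
split => //.
rewrite (eq_integral_norm_neq d l _ _ ib ib'); last first.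
  move=> t tl; rewrite /b /= /b' [\1_N t]indicE memNset; last first.
    by rewrite /N /=; exact/eqP.
  by congr EFin; rewrite /=; ring.
have mD : measurable D by exact: measurable_norm_ge.
rewrite /= /b'.
rewrite -[leRHS]/(\int[mu]_(t in D)
  (((fun t => o t * k t + c * (\1_A t * k t)) t)%:E -
   ((fun t => M * (\1_B t * k t)) t)%:E))%E.
rewrite integralB_EFin//; last exact: iZ.
have -> : (\int[mu]_(t in D) (o t * k t + c * (\1_A t * k t))%:E =
  \int[mu]_(t in D) (o t * k t)%:E + \int[mu]_(t in D) (c * (\1_A t * k t))%:E)%E.
  by rewrite -integralD//; exact: iZ.
rewrite integral_odd//; last 3 first.
- by move=> t; rewrite /D /= normrN.
- by apply: measurable_funM => //; exact: measurable_kern.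
- by move=> t; rewrite oN kernN mulNr.
rewrite add0e EFinB.
have -> : (\int[mu]_(t in D) (c * (\1_A t * k t))%:E =
  c%:E * \int[mu]_(t in D) (\1_A t * k t)%:E)%E.
  by rewrite -integralZl//; exact: i1.
have -> : (\int[mu]_(t in D) (M * (\1_B t * k t))%:E =
  M%:E * \int[mu]_(t in D) (\1_B t * k t)%:E)%E.
  by rewrite -integralZl//; exact: i1.
rewrite integral_indic_tail// -EFinM leeB// EFinM lee_wpmul2l ?lee_fin//.
exact: integral_kern_shell_ge.
Qed.

End tail.

(** * Euclidean geometry and strictly convex sets *)

Section euclid.
Context {R : realType} {N : nat}.
Implicit Types x y z : 'rV[R]_N.

Lemma edotC x y : edot x y = edot y x.
Proof. by apply: eq_bigr => i _; rewrite mulrC. Qed.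

Lemma edotDr x y z : edot x (y + z) = edot x y + edot x z.
Proof. by rewrite -big_split; apply: eq_bigr => i _; rewrite mxE mulrDr. Qed.

Lemma edotZr (a : R) x y : edot x (a *: y) = a * edot x y.
Proof. by rewrite mulr_sumr; apply: eq_bigr => i _; rewrite mxE mulrCA. Qed.

Lemma edotNr x y : edot x (- y) = - edot x y.
Proof. by rewrite -scaleN1r edotZr mulN1r. Qed.

Lemma edotBr x y z : edot x (y - z) = edot x y - edot x z.
Proof. by rewrite edotDr edotNr. Qed.

Lemma edotDl x y z : edot (x + y) z = edot x z + edot y z.
Proof. by rewrite ![edot _ z]edotC edotDr. Qed.

Lemma edotZl (a : R) x y : edot (a *: x) y = a * edot x y.
Proof. by rewrite edotC edotZr edotC. Qed.

Lemma edotNl x y : edot (- x) y = - edot x y.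
Proof. by rewrite edotC edotNr edotC. Qed.

Lemma edotBl x y z : edot (x - y) z = edot x z - edot y z.
Proof. by rewrite edotDl edotNl. Qed.

Lemma edot_ge0 x : 0 <= edot x x.
Proof. by apply: sumr_ge0 => i _; rewrite -expr2 sqr_ge0. Qed.

Lemma enorm_ge0 x : 0 <= enorm x.
Proof. exact: sqrtr_ge0. Qed.

Lemma enormK x : enorm x * enorm x = edot x x.
Proof. by rewrite -expr2 sqr_sqrtr ?edot_ge0. Qed.

Lemma coord_le_enorm x i : `|x ord0 i| <= enorm x.
Proof.
rewrite -sqrtr_sqr ler_wsqrtr// /edot (bigD1 i)//= -expr2 lerDl.
by apply: sumr_ge0 => j _; rewrite -expr2 sqr_ge0.
Qed.

Lemma enorm_eq0 x : enorm x = 0 -> x = 0.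
Proof.
move=> x0; apply/rowP => i; rewrite mxE; apply/eqP.
by rewrite -normr_le0 -x0 coord_le_enorm.
Qed.

Lemma enorm0 : enorm (0 : 'rV[R]_N) = 0.
Proof.
by rewrite /enorm /edot big1 ?sqrtr0// => i _; rewrite mxE mul0r.
Qed.

Lemma enorm_gt0 x : x != 0 -> 0 < enorm x.
Proof.
by move=> x0; rewrite lt0r enorm_ge0 andbT; apply: contra x0 => /eqP/enorm_eq0->.
Qed.

Lemma enormZ (a : R) x : enorm (a *: x) = `|a| * enorm x.
Proof.
by rewrite /enorm edotZl edotZr mulrA -expr2 sqrtrM ?sqr_ge0// sqrtr_sqr.
Qed.

Lemma enormN x : enorm (- x) = enorm x.
Proof. by rewrite -scaleN1r enormZ normrN1 mul1r. Qed.

Lemma enorm_distC x y : enorm (x - y) = enorm (y - x).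
Proof. by rewrite -enormN opprB. Qed.

Lemma edot_le_enorm x y : edot x y <= enorm x * enorm y.
Proof.
have [->|x0] := eqVneq x 0.
  by rewrite enorm0 mul0r /edot big1// => i _; rewrite mxE mul0r.
have [->|y0] := eqVneq y 0.
  by rewrite enorm0 mulr0 /edot big1// => i _; rewrite mxE mulr0.
have := edot_ge0 (enorm y *: x - enorm x *: y).
rewrite edotBl !edotBr !edotZl !edotZr -!enormK (edotC y x).
rewrite [X in 0 <= X](_ : _ =
  2 * (enorm x * enorm y * (enorm x * enorm y - edot x y))); last by ring.
by rewrite pmulr_rge0// pmulr_rge0 ?mulr_gt0 ?enorm_gt0// subr_ge0.
Qed.

Lemma enormD_le x y : enorm (x + y) <= enorm x + enorm y.
Proof.
have := enormK (x + y); rewrite edotDl !edotDr -!enormK (edotC y x).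
have := edot_le_enorm x y; have := enorm_ge0 x; have := enorm_ge0 y.
have := enorm_ge0 (x + y); nra.
Qed.

Lemma mx_norm_le_enorm x : `|x| <= enorm x.
Proof.
rewrite [leLHS]/Num.norm /= mx_normrE.
apply/bigmax_leP; split; first exact: enorm_ge0.
by move=> [i j] _ /=; rewrite ord1; exact: coord_le_enorm.
Qed.

Lemma edot_continuous x : continuous (edot x).
Proof.
move=> y; apply: (@cvg_big _ _ +%R 0 xpredT add_continuous _ (nbhs y)) => i _.
  apply: cvgM; first exact: cvg_cst.
exact: coord_continuous.
Qed.

Lemma enorm_continuous : continuous (@enorm R N).
Proof.
move=> y; apply: (@continuous_comp _ _ _ (fun y => edot y y) (@Num.sqrt R)).
  apply: (@cvg_big _ _ +%R 0 xpredT add_continuous _ (nbhs y)) => i _.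
  by apply: cvgM; exact: coord_continuous.
exact: sqrt_continuous.
Qed.

Lemma enormB_continuous x : continuous (fun y => enorm (y - x)).
Proof.
move=> y; apply: (@continuous_comp _ _ _ (fun y => y - x) (@enorm R N)).
  by apply: (@continuousB _ _ _ id (cst x)); [exact: cvg_id|exact: cst_continuous].
exact: enorm_continuous.
Qed.

Lemma nbhs_eball x (r : R) : 0 < r -> nbhs x (eball x r).
Proof.
move=> r0; have := enormB_continuous x x.
rewrite /continuous_at subrr enorm0 => /cvgrPdist_lt /(_ r r0).
by apply: filterS => y; rewrite sub0r normrN ger0_norm ?enorm_ge0.
Qed.

Lemma eball_nbhs x (A : set 'rV[R]_N) : nbhs x A ->
  exists2 r : R, 0 < r & eball x r `<=` A.
Proof.
move=> /nbhs_normP[e /= e0 eA]; exists e => // y yx; apply: eA => /=.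
by apply: le_lt_trans (mx_norm_le_enorm _) _; rewrite enorm_distC.
Qed.

End euclid.

(** The sets [A i] are a base of a proper filter, and the point found is one of its cluster points.
    Stated for sets that need not be closed, this replaces the extraction of convergent subsequences
    in the arguments below. *)
Lemma compact_directed (T : topologicalType) (I : Type) (K : set T)
    (D : set I) (A : I -> set T) : compact K -> D !=set0 ->
  (forall i, D i -> A i !=set0 /\ A i `<=` K) ->
  (forall i j, D i -> D j -> exists2 k, D k & A k `<=` A i `&` A j) ->
  exists2 x, K x & forall i U, D i -> nbhs x U -> A i `&` U !=set0.
Proof.
move=> cK [i0 Di0] AK Adir.
have FF : Filter (filter_from D A) by apply: filter_from_filter => //; exists i0.
have PF : ProperFilter (filter_from D A).
  by apply: filter_from_proper => i Di; have [] := AK i Di.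
have [|x [Kx clx]] := cK _ PF.
  by exists i0 => //; have [] := AK i0 Di0.
by exists x => // i U Di Ux; apply: clx => //; exists i.
Qed.

(** The sublevel sets at the values [J y] are nested, and by lower semicontinuity a cluster point of
    them cannot lie above any of these values. *)
Lemma lsc_compact_min (T : topologicalType) (R : realFieldType) (K : set T)
    (J : T -> R) : compact K -> K !=set0 ->
  (forall x e, K x -> 0 < e -> \forall y \near x, J x - e < J y) ->
  exists2 x, K x & forall y, K y -> J x <= J y.
Proof.
move=> cK K0 lscJ.
have [] := @compact_directed T T K K (fun y => [set x | K x /\ J x <= J y]) cK K0.
- by move=> y Ky; split; [exists y => /=|move=> x []].
- move=> y1 y2 K1 K2; case: (leP (J y1) (J y2)) => J12.
    exists y1 => // x /= [Kx xy]; split; split => //; lra.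
  exists y2 => // x /= [Kx xy]; split; split => //; lra.
move=> x Kx clx; exists x => // y Ky; rewrite leNgt; apply/negP => yx.
have e0 : 0 < J x - J y by lra.
have [z [[_ zy] /=]] := clx _ _ Ky (lscJ _ _ Kx e0); lra.
Qed.

(** * Separation, supporting hyperplanes and caps *)

Section convex.
Context {R : realType} {N : nat}.
Implicit Types (x y z a nu : 'rV[R]_N) (Om : set 'rV[R]_N).

Lemma edot_sub_scale x y (l : R) : edot (x - l *: y) (x - l *: y) =
  edot x x - 2 * l * edot x y + l * l * edot y y.
Proof. by rewrite edotBl !edotBr !edotZl !edotZr (edotC y x); ring. Qed.

Lemma is_derive_edot a x v : is_derive x v (edot a) (edot a v).
Proof.
have h : (fun h : R => h^-1 *: ((edot a \o shift x) (h *: v) - edot a x)) @ 0^'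
    --> edot a v.
  apply: cvg_near_cst; near=> h.
  rewrite /= edotDr edotZr addrK /GRing.scale /= mulrA mulVf ?mul1r//.
  by near: h; exact: nbhs_dnbhs_neq.
apply: DeriveDef; first by apply/cvg_ex; exists (edot a v).
exact/cvg_lim.
Unshelve. all: by end_near. Qed.

Lemma C2_edot a : C2 (edot a).
Proof.
have dE i : (fun x => derive (edot a) x (evec R i)) = cst (edot a (evec R i)).
  by apply/funext => x; have [_ ->] := is_derive_edot a x (evec R i).
split; first exact: edot_continuous.
move=> i j; split; first by move=> x; have [] := is_derive_edot a x (evec R i).
rewrite dE; split; first exact: cst_continuous.
split; first by move=> x; exact: derivable_cst.
have -> : (fun x => derive (cst (edot a (evec R i))) x (evec R j)) = cst 0.
  by apply/funext => x; rewrite derive_cst.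
exact: cst_continuous.
Qed.

Lemma compact_closure Om : bounded_domain Om -> compact (closure Om).
Proof.
move=> [_ [_ [_ [M OmM]]]].
apply: bounded_closed_compact; last exact: closed_closure.
exists M; split; first exact: num_real.
move=> M' MM' y cy; apply/ltW; apply: le_lt_trans MM'.
rewrite leNgt; apply/negP => Mn.
have [z [Oz /= zM]] : Om `&` [set z | M < `|z|] !=set0.
  apply: cy; have := @norm_continuous _ _ y.
  by move=> /(_ [set t | M < t]); apply; exact: open_nbhs_nbhs.
by have := OmM z Oz; have := mx_norm_le_enorm z; lra.
Qed.

Lemma compact_sphere : compact (@sphere R N).
Proof.
apply: bounded_closed_compact.
  exists 1; split; first exact: num_real.
  by move=> M M1 z /= z1; rewrite ltW// (le_lt_trans (mx_norm_le_enorm z))// z1.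
have -> : @sphere R N = (@enorm R N) @^-1` [set 1] by [].
by apply: closed_comp => [z _|]; [exact: enorm_continuous|exact: closed_eq].
Qed.

Lemma segment_closure Om x y (l : R) : strictly_convex Om -> 
  closure Om x -> closure Om y -> 0 < l < 1 -> closure Om (x + l *: (y - x)).
Proof.
move=> sc cx cy l01; have [<-|xy] := eqVneq x y.
  by rewrite subrr scaler0 addr0.
apply: subset_closure; have := sc x y cx cy xy l l01.
by rewrite scalerBr scalerBl scale1r addrAC addrA.
Qed.

(** The normal is the direction from the nearest point [p] of the closure to [q]. Every point of the
    closure is seen from [p] at a right or obtuse angle to this direction. *)
Lemma separation Om q : bounded_domain Om -> strictly_convex Om ->
  ~ closure Om q ->
  exists2 nu, enorm nu = 1 & forall y, closure Om y -> edot nu (y - q) <= 0.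
Proof.
move=> bd sc Kq.
have [|||p Kp pmin] := @lsc_compact_min _ R (closure Om) (fun y => enorm (y - q)).
- exact: compact_closure.
- by have [[y Oy] _] := bd; exists y; exact: subset_closure.
- move=> x e _ e0; have /cvgrPdist_lt/(_ e e0) := enormB_continuous q x.
  by apply: filterS => y; rewrite ltr_norml => /andP[_]; lra.
have pq : 0 < enorm (q - p).
  by apply: enorm_gt0; rewrite subr_eq0; apply: contra_notN Kq => /eqP->.
have obtuse y : closure Om y -> edot (q - p) (y - p) <= 0.
  move=> Ky; rewrite leNgt; apply/negP => al0.
  have be0 := edot_ge0 (y - p).
  move: al0 be0 (al0); set al := edot _ _; set be := edot _ _ => al0 be0 _.
  (* With [l * be <= al], moving from [p] towards [y] by the fraction [l] changes the squared
     distance to [q] by at most [- l * al < 0]. The summand [1] keeps [l] below [1]. *)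
  pose l := al / (al + be + 1).
  have l01 : 0 < l < 1.
    by rewrite /l divr_gt0 ?ltr_pdivrMr /=; lra.
  have lbe : l * be <= al.
    by rewrite /l mulrAC ler_pdivrMr; nra.
  have := pmin _ (segment_closure Om p y l sc Kp Ky l01).
  have -> : p + l *: (y - p) - q = - ((q - p) - l *: (y - p)).
    by apply/rowP => i; rewrite !mxE; ring.
  rewrite enormN enorm_distC => le_n.
  have : enorm (q - p) * enorm (q - p) <=
      enorm (q - p - l *: (y - p)) * enorm (q - p - l *: (y - p)) by nra.
  rewrite !enormK edot_sub_scale -/al -/be => h.
  have {}h : l * (2 * al) <= l * (l * be) by nra.
  by move: h; rewrite ler_pM2l; lra.
exists ((enorm (q - p))^-1 *: (q - p)).
  by rewrite enormZ gtr0_norm ?invr_gt0// mulVf// gt_eqF.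
move=> y Ky; rewrite edotZl pmulr_rle0 ?invr_gt0//.
have -> : y - q = (y - p) - (q - p) by rewrite opprB addrA subrK.
by rewrite edotBr; have := obtuse y Ky; have := edot_ge0 (q - p); lra.
Qed.

(** Otherwise [x] would lie strictly between two distinct points of the closure, hence in [Om]. *)
Lemma line_exit Om x y (t : R) : strictly_convex Om -> boundary Om x ->
  Om y -> 0 < t -> ~ closure Om (x + t *: (x - y)).
Proof.
move=> sc [Kx nOx] Oy t0 Kq; apply: (nOx).
have t1 : 0 < 1 + t by lra.
have yq : y != x + t *: (x - y).
  apply: contra_notN nOx => /eqP /rowP yq; suff -> : x = y by [].
  apply/rowP => i; have := yq i; rewrite !mxE; nra.
have -> : x = (1 - (1 + t)^-1) *: y + (1 + t)^-1 *: (x + t *: (x - y)).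
  by apply/rowP => i; rewrite !mxE; field; rewrite gt_eqF.
apply: sc => //; first exact: subset_closure.
by rewrite invr_gt0 t1 invf_lt1//; lra.
Qed.

(** Points outside the closure and close to [x0] are separated from it; compactness of the sphere
    gives a limit of the separating normals. *)
Lemma supporting_hyperplane Om x0 : bounded_domain Om -> strictly_convex Om ->
  boundary Om x0 ->
  exists2 nu, enorm nu = 1 & forall y, closure Om y -> edot nu (y - x0) <= 0.
Proof.
move=> bd sc bx0.
have near_support e : 0 < e -> exists nu, enorm nu = 1 /\
    forall y, closure Om y -> edot nu (y - x0) <= e.
  move=> e0; have [[y1 Oy1] _] := bd.
  have xy : 0 < enorm (x0 - y1).
    apply: enorm_gt0; rewrite subr_eq0; case: bx0 => _ nO.
    by apply: contra_notN nO => /eqP->.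
  (* With this parameter the outer point [q] is at distance exactly [e] from [x0], so moving the
     hyperplane from [q] to [x0] costs at most [e]. *)
  have t0 : 0 < e / enorm (x0 - y1) by rewrite divr_gt0.
  have := line_exit Om x0 y1 _ sc bx0 Oy1 t0.
  set q := x0 + _ => Kq; have [nu nu1 nuP] := separation Om q bd sc Kq.
  exists nu; split => // y Ky.
  have -> : y - x0 = (y - q) + (q - x0) by rewrite addrA subrK.
  rewrite edotDr; have := nuP y Ky.
  have := edot_le_enorm nu (q - x0).
  rewrite nu1 mul1r {3}/q addrAC subrr add0r enormZ gtr0_norm//.
  by rewrite divfK ?gt_eqF//; lra.
have [] := @compact_directed _ R (@sphere R N) [set e | 0 < e]
  (fun e => [set nu | sphere nu /\ forall y, closure Om y -> edot nu (y - x0) <= e]).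
- exact: compact_sphere.
- by exists 1 => /=.
- move=> e e0; split; last by move=> nu [].
  by have [nu nuP] := near_support e e0; exists nu.
- move=> e1 e2 /= h1 h2; case: (leP e1 e2) => h12.
    exists e1 => // nu [n1 nP]; split; split => // y Ky; have := nP y Ky; lra.
  exists e2 => // nu [n1 nP]; split; split => // y Ky; have := nP y Ky; lra.
move=> nu nu1 clnu; exists nu => // y Ky; rewrite leNgt; apply/negP => h.
set e := edot nu (y - x0) in h; have e2 : 0 < e / 2 by lra.
have : \forall mu \near nu, e / 2 < edot mu (y - x0).
  have /cvgrPdist_lt/(_ _ e2) := edot_continuous (y - x0) nu.
  apply: filterS => mu; rewrite ltr_norml => /andP[_].
  by rewrite !(edotC (y - x0)) -/e; lra.
by move=> /(clnu _ _ e2)[mu [[_ /(_ y Ky)] /=]]; lra.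
Qed.

(** If it fails, compactness gives a second point [y] of the closure on the supporting hyperplane.
    The midpoint of [x0] and [y] is then in the open set [Om] and on the hyperplane, so a small
    shift along [nu] crosses it. *)
Lemma caps_shrink Om x0 nu (rho : R) : bounded_domain Om -> strictly_convex Om ->
  boundary Om x0 -> enorm nu = 1 ->
  (forall y, closure Om y -> edot nu (y - x0) <= 0) -> 0 < rho ->
  exists2 eta, 0 < eta &
    forall y, closure Om y -> - eta <= edot nu (y - x0) -> enorm (y - x0) < rho.
Proof.
move=> bd sc bx0 nu1 nuP rho0; apply: contrapT => H.
have [] := @compact_directed _ R (closure Om) [set e | 0 < e]
  (fun e => [set y | [/\ closure Om y, - e <= edot nu (y - x0) &
     rho <= enorm (y - x0)]]).
- exact: compact_closure.
- by exists 1 => /=.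
- move=> e e0; split; last by move=> nu' [].
  apply: contrapT => /nonemptyPn H2; apply: H; exists e => // y Ky ey.
  rewrite ltNge; apply/negP => ry.
  by have : set0 y by rewrite -H2; split.
- move=> e1 e2 /= h1 h2; case: (leP e1 e2) => h12.
    exists e1 => // y [Ky ye yr]; split; split => //; lra.
  exists e2 => // y [Ky ye yr]; split; split => //; lra.
move=> y Ky cly.
have yr : rho <= enorm (y - x0).
  rewrite leNgt; apply/negP => h.
  have e0 : 0 < rho - enorm (y - x0) by lra.
  have /cvgrPdist_lt/(_ _ e0) := enormB_continuous x0 y.
  move=> /(cly 1 _ ltr01)[z [[_ _ zr] /=]]; rewrite ltr_norml; lra.
have y0 : edot nu (y - x0) = 0.
  apply/eqP; rewrite eq_le nuP//= leNgt; apply/negP => h.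
  set e := edot nu (y - x0) in h; have e2 : 0 < - e / 2 by lra.
  have : \forall z \near y, edot nu z < edot nu y - e / 2.
    have /cvgrPdist_lt/(_ _ e2) := edot_continuous nu y.
    by apply: filterS => z; rewrite ltr_norml; lra.
  have eE : e = edot nu y - edot nu x0 by rewrite /e edotBr.
  by move=> /(cly _ _ e2)[z [[_ + _] /=]]; rewrite edotBr; lra.
have yx : x0 != y.
  by apply: contraTneq yr => <-; rewrite subrr enorm0 -ltNge.
have Om12 : Om ((1 - 2^-1) *: x0 + 2^-1 *: y).
  by apply: sc => //; [case: bx0|lra].
have [_ [oOm _]] := bd.
have [r r0 rO] := eball_nbhs _ _ (open_nbhs_nbhs (conj oOm Om12)).
have /rO/subset_closure/nuP :
    eball ((1 - 2^-1) *: x0 + 2^-1 *: y) r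
          ((1 - 2^-1) *: x0 + 2^-1 *: y + (r / 2) *: nu).
  by rewrite /eball /= addrAC subrr add0r enormZ nu1 gtr0_norm; lra.
move: y0; rewrite !(edotBr, edotDr, edotZr) -(enormK nu) nu1; lra.
Qed.

End convex.

(** * Exit times, extensions and semicontinuous envelopes *)

Section exit_time.
Context {R : realType} {N : nat}.
Implicit Types (x y z a nu : 'rV[R]_N) (Om : set 'rV[R]_N).

(** [l] is the supremum of the times at which both opposite points of the line are in the closure,
    and [sg] selects a half line that has left it after [l]. For [x] on the boundary [l] may be
    [0]. *)
Lemma exit_time Om x z (rho : R) : strictly_convex Om -> closure Om x -> z != 0 ->
  (forall t, 0 <= t -> closure Om (x + t *: z) -> closure Om (x - t *: z) ->
     t <= rho) ->
  exists l sg : R, [/\ 0 <= l <= rho, sg = 1 \/ sg = - 1,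
    forall t, `|t| < l -> Om (x + t *: z) &
    forall t, l < t -> ~ closure Om (x + (sg * t) *: z)].
Proof.
move=> sc Kx z0 Hrho.
pose T := [set t : R |
  [/\ 0 <= t, closure Om (x + t *: z) & closure Om (x - t *: z)]].
have T0 : T 0 by rewrite /T /= scale0r addr0 subr0.
have Tub : has_ubound T by exists rho => t [t0 t1 t2]; exact: Hrho.
have Tsup : has_sup T by split; [exists 0|].
pose l := sup T.
have l0 : 0 <= l by exact: ub_le_sup.
have lrho : l <= rho by apply: ge_sup; [exists 0|move=> t [t0 t1 t2]; exact: Hrho].
have inOm t : `|t| < l -> Om (x + t *: z).
  move=> tl; have e0 : 0 < l - `|t| by lra.
  have [t' [t'0 Kp Km]] := sup_adherent e0 Tsup; rewrite -/l => tt'.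
  have {}tt' : `|t| < t' by lra.
  have t'p : 0 < t' by have := normr_ge0 t; lra.
  (* The point is a strict convex combination of the two ends at time [t'], so strict convexity puts
     it in [Om] itself. *)
  have -> : x + t *: z = (1 - (t + t') / (2 * t')) *: (x - t' *: z) +
      ((t + t') / (2 * t')) *: (x + t' *: z).
    by apply/rowP => i; rewrite !mxE; field; rewrite gt_eqF.
  apply: sc => //.
    apply: contra z0 => /eqP/rowP E; apply/eqP/rowP => i.
    by have := E i; rewrite !mxE; nra.
  move: tt'; rewrite ltr_norml => /andP[t1 t2].
  rewrite divr_gt0 ?ltr_pdivrMr /=; lra.
have KS (m t1 : R) w : 0 <= m -> m <= t1 -> closure Om (x + t1 *: w) ->
    closure Om (x + m *: w).
  rewrite le_eqVlt => /predU1P[<-|m0]; first by rewrite scale0r addr0.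
  rewrite le_eqVlt => /predU1P[->//|mt] K1.
  have := segment_closure Om x (x + t1 *: w) (m / t1) sc Kx K1.
  rewrite addrAC subrr add0r scalerA divfK; last by rewrite gt_eqF; lra.
  by apply; rewrite divr_gt0 ?ltr_pdivrMr /=; lra.
(* If the positive half line meets the closure after [l], the negative one cannot: the smaller of
   the two times would belong to [T] and exceed its supremum. *)
have [[t1 lt1 K1]|H1] := pselect (exists2 t, l < t & closure Om (x + t *: z)).
  exists l, (- 1); split => //; [by rewrite l0|by right|].
  move=> t2 lt2; rewrite mulN1r scaleNr -scalerN => K2.
  pose m := Num.min t1 t2.
  have m1 : m <= t1 by rewrite /m ge_min lexx.
  have m2 : m <= t2 by rewrite /m ge_min lexx orbT.
  have lm : l < m by rewrite /m lt_min lt1.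
  have : T m.
    split; [lra|apply: KS K1 => //; lra|].
    by rewrite -scalerN; apply: KS K2 => //; lra.
  by move=> /(ub_le_sup Tub); rewrite -/l; lra.
exists l, 1; split => //; [by rewrite l0|by left|].
by move=> t lt Kt; apply: H1; exists t => //; rewrite -[t]mul1r.
Qed.

(** Values of [g] enter only off [Om], hence on the closure of the complement, the only place where
    [g] is controlled. *)
Lemma ext_low_ge Om (L g : 'rV[R]_N -> R) y (m : R) : m <= L y ->
  (closure (~` Om) y -> m <= g y) -> m <= ext_low Om L g y.
Proof.
move=> mL mg; rewrite /ext_low; case: ifPn => // yO.
have {}mg : m <= g y.
  by apply: mg; apply: subset_closure; move: yO; rewrite notin_setE.
by case: ifPn => // _; rewrite le_min mL.
Qed.

Lemma ext_low_Om Om (L g : 'rV[R]_N -> R) y : Om y -> ext_low Om L g y = L y.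
Proof. by move=> Oy; rewrite /ext_low mem_set. Qed.

Lemma ext_low_out Om (L g : 'rV[R]_N -> R) y : ~ closure Om y ->
  ext_low Om L g y = g y.
Proof.
move=> Ky; rewrite /ext_low memNset; last by move/subset_closure.
by rewrite memNset.
Qed.

Lemma ext_upN Om (L g : 'rV[R]_N -> R) y :
  ext_up Om L g y = - ext_low Om (fun x => - L x) (fun x => - g x) y.
Proof.
rewrite /ext_up /ext_low; case: ifP => _; first by rewrite opprK.
by case: ifP => _; rewrite ?opprK// -oppr_max opprK.
Qed.

Lemma eball_center x (r : R) : 0 < r -> eball x r x.
Proof. by rewrite /eball /= subrr enorm0. Qed.

Section envelope.
Variables (v : 'rV[R]_N -> R) (M : R).
Hypothesis vM : forall x, `|v x| <= M.

Let has_inf_ball x (r : R) : 0 < r -> has_inf (v @` eball x r).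
Proof.
move=> r0; split; first by exists (v x), x => //; exact: eball_center.
by exists (- M) => _ [y _ <-]; have := vM y; rewrite ler_norml => /andP[].
Qed.

Let inf_ball_le x (r : R) : 0 < r -> inf (v @` eball x r) <= v x.
Proof.
move=> r0; apply: ge_inf; first by have [] := has_inf_ball x r r0.
by exists x => //; exact: eball_center.
Qed.

Let has_sup_env x :
  has_sup [set inf (v @` eball x r) | r in [set r : R | 0 < r]].
Proof.
split; first by exists (inf (v @` eball x 1)), 1 => /=.
by exists (v x) => _ [r /= r0 <-]; exact: inf_ball_le.
Qed.

Lemma lsc_env_le x : lsc_env v x <= v x.
Proof.
apply: ge_sup; first by have [] := has_sup_env x.
by move=> _ [r /= r0 <-]; exact: inf_ball_le.
Qed.

Lemma lsc_env_norm_le x : `|lsc_env v x| <= M.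
Proof.
rewrite ler_norml; apply/andP; split; last first.
  by apply: le_trans (lsc_env_le x) _; have := vM x; rewrite ler_norml => /andP[].
apply: (@le_trans _ _ (inf (v @` eball x 1))).
  apply: lb_le_inf; first by have [] := has_inf_ball x 1 ltr01.
  by move=> _ [y _ <-]; have := vM y; rewrite ler_norml => /andP[].
by apply: ub_le_sup; [have [] := has_sup_env x|exists 1 => /=].
Qed.

Lemma lsc_env_lsc x (e : R) : 0 < e ->
  exists2 r, 0 < r & forall y, eball x r y -> lsc_env v x - e < lsc_env v y.
Proof.
move=> e0; have [_ [r /= r0 <-] h] := sup_adherent e0 (has_sup_env x).
exists r => // y yr; apply: lt_le_trans h _.
(* By the triangle inequality the ball of radius [q] about [y] is inside the ball of radius [r]
   about [x], so its infimum is no smaller. *)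
pose q := r - enorm (y - x).
have q0 : 0 < q by rewrite /q; move: yr; rewrite /eball /=; lra.
apply: (@le_trans _ _ (inf (v @` eball y q))); last first.
  by apply: ub_le_sup; [have [] := has_sup_env y|exists q].
apply: lb_le_inf; first by have [] := has_inf_ball y q q0.
move=> _ [w wq <-]; apply: ge_inf; first by have [] := has_inf_ball x r r0.
exists w => //; rewrite /eball /=.
have -> : w - x = (w - y) + (y - x) by rewrite addrA subrK.
by have := enormD_le (w - y) (y - x); move: wq; rewrite /eball /q /=; lra.
Qed.

End envelope.

Lemma usc_envN (u : 'rV[R]_N -> R) x :
  usc_env u x = - lsc_env (fun y => - u y) x.
Proof.
rewrite /usc_env /lsc_env /inf; congr (- sup _).
rewrite image_comp; apply: eq_imagel => r r0 /=.
by rewrite image_comp /=; congr (- sup _); apply: eq_imagel => y _ /=; rewrite opprK.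
Qed.

End exit_time.

(** The quantity equals half of [2 * rho] to the power [- 2 * s], which blows up as [rho] tends to
    [0]; [y] is the value of [2 * rho] making it [|A| + 1 / 2]. *)
Lemma shell_mass_unbounded (R : realType) (s A r : R) : 0 < s -> 0 < r ->
  exists2 rho, 0 < rho < r & A <= rho * kern s (2 * rho).
Proof.
move=> s0 r0; have s2 : 0 < 2 * s by lra.
pose y := ((2 * `|A| + 1)^-1) `^ ((2 * s)^-1).
have A0 : 0 < 2 * `|A| + 1 by have := normr_ge0 A; lra.
have y0 : 0 < y by apply: powR_gt0; rewrite invr_gt0.
have ys : y `^ (2 * s) = (2 * `|A| + 1)^-1.
  by rewrite /y -powRrM mulVf ?gt_eqF// powRr1// invr_ge0 ltW.
pose m := Num.min y r; have m0 : 0 < m by rewrite /m lt_min y0.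
exists (m / 2).
  have : m <= r by rewrite /m ge_min lexx orbT.
  by lra.
have -> : 2 * (m / 2) = m by field.
have my : m `^ (2 * s) <= (2 * `|A| + 1)^-1.
  rewrite -ys; apply: ge0_ler_powR; rewrite ?nnegrE ?(ltW s2) ?(ltW m0) ?(ltW y0)//.
  by rewrite /m ge_min lexx.
rewrite /kern gtr0_norm// powRD; last by rewrite (gt_eqF m0) implybT.
rewrite powRr1 ?ltW// invfM mulrA.
have -> : m / 2 / m = 2^-1 by field; rewrite gt_eqF.
have {}my : 2 * `|A| + 1 <= (m `^ (2 * s))^-1.
  by rewrite -[leLHS]invrK lef_pV2 ?posrE ?powR_gt0 ?invr_gt0.
by have := ler_norm A; lra.
Qed.

(** * The barrier *)

Section profile.
Context {R : realType}.
Variables (beta e l r : R).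

(** Linear with slope [beta] inside [|t| < l], equal to [e] and [- e] on the two sides of
    [l < |t| < r], and [0] elsewhere. The truncation makes it bounded, hence integrable against the
    kernel away from [0]. *)
Definition odd_profile (t : R) : R :=
  beta * (t * \1_(`]- l, l[%classic : set R) t) +
  e * (\1_(`]l, r[%classic : set R) t - \1_(`]- r, - l[%classic : set R) t).

Lemma measurable_odd_profile : measurable_fun [set: R] odd_profile.
Proof.
have mI (a b : R) : measurable_fun [set: R] (\1_(`]a, b[%classic : set R) : R -> R).
  by apply: measurable_indic; exact: measurable_itv.
apply: measurable_funD; apply: measurable_funM => //.
  exact: measurable_funM.
exact: measurable_funB.
Qed.

Lemma odd_profileN t : odd_profile (- t) = - odd_profile t.
Proof.
rewrite /odd_profile !indicE.
have flip (a b : R) : (- t \in (`]a, b[%classic : set R)) =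
    (t \in (`]- b, - a[%classic : set R)).
  by apply/idP/idP; rewrite !inE /= !in_itv /=; lra.
by rewrite !flip !opprK; ring.
Qed.

Lemma odd_profile_bounded : 0 <= l ->
  forall t, `|odd_profile t| <= `|beta| * l + `|e|.
Proof.
move=> l0 t; rewrite (le_trans (ler_normD _ _))// !normrM lerD//.
  rewrite ler_wpM2l// indicE; case: (boolP (t \in _)).
    by rewrite inE /= in_itv /= normr1 mulr1 ler_norml; lra.
  by rewrite normr0 mulr0.
rewrite -[leRHS]mulr1 ler_wpM2l// !indicE.
case: (_ \in _); case: (_ \in _); rewrite ?subrr ?subr0 ?sub0r ?normrN;
  by rewrite ?normr0 ?normr1.
Qed.

Lemma odd_profile_small t : `|t| < l -> odd_profile t = beta * t.
Proof.
rewrite ltr_norml => /andP[t1 t2]; rewrite /odd_profile !indicE.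
rewrite mem_set /= ?in_itv /=; last lra.
rewrite !memNset /= ?in_itv /=; [|lra..].
by rewrite subrr mulr0 addr0 mulr1.
Qed.

Lemma odd_profile_right t : 0 <= l -> l < t < r -> odd_profile t = e.
Proof.
move=> l0 tlr; rewrite /odd_profile !indicE.
rewrite memNset /= ?in_itv /=; last lra.
rewrite mem_set /= ?in_itv /=; last lra.
rewrite memNset /= ?in_itv /=; last lra.
by ring.
Qed.

Lemma odd_profile_out t : 0 <= l -> `|t| = l \/ r <= `|t| /\ l < r ->
  odd_profile t = 0.
Proof.
move=> l0 tlr; rewrite /odd_profile !indicE.
have tt : t = `|t| \/ t = - `|t|.
  by case: (ger0P t) => _; [left|right]; rewrite ?opprK.
have t0 := normr_ge0 t.
have out : [/\ ~ (- l < t < l : bool), ~ (l < t < r : bool)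
    & ~ (- r < t < - l : bool)].
  by move: t0 tt tlr; set n := `|t| => t0 tt tlr; split => h; case: tt => h2;
    case: tlr => [|[]]; lra.
by have [h1 h2 h3] := out; rewrite !memNset /= ?in_itv//; ring.
Qed.

End profile.

(** For [l < |t| < r] the bound is [3 * c] on the side that has left the closure and [- c] on the
    other; the values [2 * c] and [- 2 * c] of the profile balance these to a surplus [c] on both.
    Since [l <= rho] and [2 * rho < r], the shell where the surplus is kept lies in this range. *)
Lemma odd_profile_le (R : realType) (beta c sg l r rho M W t : R) :
  0 <= l -> l <= rho -> 2 * rho < r -> 0 < c -> 0 <= M -> sg = 1 \/ sg = - 1 ->
  - M <= W -> (`|t| < r -> - c <= W) -> (`|t| < l -> beta * t <= W) ->
  (`|t| < r -> l < sg * t -> 3 * c <= W) ->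
  odd_profile beta (2 * c * sg) l r t
    + c * \1_[set t : R | (rho < `|t| < 2 * rho)%R] t
    - M * \1_[set t : R | (r <= `|t|)%R] t
    - M * \1_[set t : R | `|t| = l] t <= W.
Proof.
move=> l0 lrho rhor c0 M0 sgE WM Wc Wl Wout.
have [tl|tl|tl] := ltgtP `|t| l.
- rewrite odd_profile_small// !indicE !memNset /=; [|lra..].
  by have := Wl tl; lra.
- have [tr|tr] := ltP `|t| r; last first.
    rewrite odd_profile_out//; last by right; split => //; lra.
    rewrite !indicE [_ \in [set t | r <= `|t|]]mem_set//= !memNset /=; [|lra..].
    by lra.
  rewrite !indicE [_ \in [set t | r <= `|t|]]memNset/=; last by lra.
  rewrite [_ \in [set t | `|t| = l]]memNset/=; last by lra.
  have ci1 : c * (t \in [set t : R | rho < `|t| < 2 * rho])%:R <= c.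
    by case: (_ \in _) => /=; lra.
  have := Wout tr; have {Wc Wl Wout} := Wc tr => Wc Wout.
  have [t0|t0] := leP 0 t.
    have tE : `|t| = t by exact: ger0_norm.
    rewrite odd_profile_right//; last lra.
    case: sgE => sgE; rewrite sgE in Wout *; last by lra.
    by have : 3 * c <= W; [apply: Wout|]; lra.
  have tE : `|t| = - t by exact: ltr0_norm.
  rewrite -[t in odd_profile _ _ _ _ t]opprK odd_profileN.
  rewrite odd_profile_right//; last lra.
  case: sgE => sgE; rewrite sgE in Wout *; first by lra.
  by have : 3 * c <= W; [apply: Wout|]; lra.
- rewrite odd_profile_out//; last by left.
  rewrite !indicE [_ \in [set t | `|t| = l]]mem_set//= !memNset /=; [|lra..].
  by lra.
Qed.

(** * The touching point and the uniform minorant *)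

Section core.
Context {R : realType} {N : nat}.
Implicit Types (x y z a nu : 'rV[R]_N) (Om : set 'rV[R]_N).
Notation mu := (@lebesgue_measure R).

Lemma within_continuous_eball (A : set 'rV[R]_N) (g : 'rV[R]_N -> R) x (e : R) :
  {within A, continuous g} -> A x -> 0 < e ->
  exists2 r, 0 < r & forall y, A y -> eball x r y -> `|g x - g y| < e.
Proof.
move=> cg Ax e0.
have /cvgrPdist_lt/(_ e e0) := cg x.
rewrite /prop_near1 /nbhs /= -nbhs_subspace_in// => /eball_nbhs[r r0 rP].
by exists r => // y Ay /rP; exact.
Qed.

(** [F] is free so that it can later beat the bound of [f]. The minorant [b] comes with its
    integrability because the use for subsolutions has to change its sign under the integral. *)
Lemma barrier (s M G F : R) Om (g L : 'rV[R]_N -> R) x0 :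
  0 < s -> bounded_domain Om -> strictly_convex Om -> boundary Om x0 ->
  (forall x, `|L x| <= M) ->
  (forall x e, 0 < e ->
     exists2 r, 0 < r & forall y, eball x r y -> L x - e < L y) ->
  {within closure (~` Om), continuous g} ->
  (forall x, closure (~` Om) x -> `|g x| <= G) ->
  (forall x, ~ closure Om x -> g x <= L x) -> L x0 < g x0 ->
  exists a xb (d : R), [/\ 0 < d, closure Om xb,
    forall x, eball xb d x -> L xb - edot a xb <= L x - edot a x,
    boundary Om xb -> L xb < g xb &
    forall z, sphere z -> exists b : R -> R,
      [/\ mu.-integrable [set t | d <= `|t|] (fun t => (b t * kern s t)%:E),
          (F%:E <= \int[mu]_(t in [set t | (d <= `|t|)%R]) (b t * kern s t)%:E)%E &
          forall t, d <= `|t| -> b t <= ext_low Om L g (xb + t *: z) - L xb]].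
Proof.
move=> s0 bd sc bx0 LM lscL cg gG gL Lg.
(* A quarter of the gap: near [x0], [L] stays above [L x0 - c] and [g] above [L x0 + 3 * c]. *)
pose c := (g x0 - L x0) / 4; have c0 : 0 < c by rewrite /c; lra.
have gE : g x0 = L x0 + 4 * c by rewrite /c; field.
have notOm x : ~ Om x -> closure (~` Om) x by exact: (@subset_closure _ (~` Om)).
have cx0 : closure (~` Om) x0 by apply: notOm; case: bx0.
have M0 : 0 <= M by apply: le_trans (LM x0).
have G0 : 0 <= G by apply: le_trans (gG x0 cx0).
have [r1 r10 r1P] := lscL x0 c c0.
have [r2 r20 r2P] := within_continuous_eball _ _ _ _ cg cx0 c0.
pose r := Num.min r1 r2 / 2.
have r0 : 0 < r by rewrite /r divr_gt0// lt_min r10.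
have rr1 : 2 * r <= r1 by rewrite /r mulrC divfK// ge_min lexx.
have rr2 : 2 * r <= r2 by rewrite /r mulrC divfK// ge_min lexx orbT.
have Lnear y : enorm (y - x0) < 2 * r -> L x0 - c < L y.
  by move=> yr; apply: r1P; rewrite /eball /=; lra.
have gnear y : closure (~` Om) y -> enorm (y - x0) < 2 * r -> L x0 + 3 * c < g y.
  move=> cy yr; have /r2P - /(_ cy) : eball x0 r2 y by rewrite /eball /=; lra.
  by rewrite ltr_norml; lra.
pose M2 := 2 * M + G.
have r20' : 0 < r / 2 by lra.
(* [r] is already fixed, so the loss from [|t| >= r] is a constant and [rho] can be taken small
   enough for the shell gain to exceed it by [F]. *)
have [rho rhor rhoA] :=
  shell_mass_unbounded R s ((F + M2 * tailmass R s r) / c) _ s0 r20'.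
have rho0 : 0 < rho by lra.
have {}rhoA : F <= c * (rho * kern s (2 * rho)) - M2 * tailmass R s r.
  by move: rhoA; rewrite ler_pdivrMr//; lra.
have [nu nu1 nuP] := supporting_hyperplane Om x0 bd sc bx0.
have [eta eta0 etaP] := caps_shrink Om x0 nu rho bd sc bx0 nu1 nuP rho0.
pose B := 4 * (M + 1) / eta.
(* Minimality and [|L| <= M] bound the depth of [xb] below the hyperplane by [2 * M / B < eta / 2].
   The half is needed for chords: the depths of two opposite points add up to twice that of [xb], so
   each is at most [eta]. *)
have B0 : 0 < B by rewrite /B divr_gt0//; lra.
pose a := B *: nu.
have [|||xb Kxb xbmin] :=
  @lsc_compact_min _ R (closure Om) (fun y => L y - edot a y).
- exact: compact_closure.
- by exists x0; case: bx0.
- move=> x e _ e0; have e2 : 0 < e / 2 by lra.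
  have [q q0 qP] := lscL x (e / 2) e2.
  have /cvgrPdist_lt/(_ _ e2) := edot_continuous a x.
  apply: filterS2 (nbhs_eball x q q0) => y /qP + ; rewrite ltr_norml; lra.
have aE y : edot a y = B * edot nu y by rewrite /a edotZl.
have hxb : edot nu (xb - x0) <= 0 by exact: nuP.
have LB : L xb - B * edot nu (xb - x0) <= L x0.
  have Kx0 : closure Om x0 by case: bx0.
  by have := xbmin x0 Kx0; rewrite !aE edotBr; lra.
have Lxb : L xb <= L x0 by nra.
have hxb2 : - (eta / 2) <= edot nu (xb - x0).
  have : B * - edot nu (xb - x0) <= 2 * M.
    have := LM xb; have := LM x0; rewrite !ler_norml; lra.
  have BE : B * eta = 4 * (M + 1) by rewrite /B divfK// gt_eqF.
  move=> h; rewrite leNgt; apply/negP => h2; nra.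
have xbrho : enorm (xb - x0) < rho by apply: etaP => //; lra.
(* On this ball the affine function varies by at most [c], less than the jump of at least [3 * c]
   from [L xb] to the values of [L] outside the closure. *)
pose d := Num.min rho (c / B).
have d0 : 0 < d by rewrite /d lt_min rho0 divr_gt0.
have drho : d <= rho by rewrite /d ge_min lexx.
have dB : B * d <= c by rewrite mulrC -ler_pdivlMr// /d ge_min lexx orbT.
exists a, xb, d; split => //.
- move=> x xd; have [Kx|Kx] := pselect (closure Om x); first exact: xbmin.
  have xx0 : enorm (x - x0) < 2 * r.
    have -> : x - x0 = (x - xb) + (xb - x0) by rewrite addrA subrK.
    have := enormD_le (x - xb) (xb - x0); move: xd; rewrite /eball /=; lra.
  have nOx : ~ Om x by move/subset_closure.
  have := gnear x (notOm x nOx) xx0; have := gL x Kx.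
  have := edot_le_enorm nu (x - xb); rewrite nu1 mul1r edotBr !aE.
  move: xd; rewrite /eball /=; nra.
- move=> [_ nOxb]; have := gnear xb (notOm xb nOxb).
  by move=> /(_ _); lra.
move=> z z1.
have z0 : z != 0.
  apply/eqP => z0; move: z1; rewrite /sphere /= z0 enorm0 => /eqP.
  by rewrite eq_sym oner_eq0.
have enz t : enorm (t *: z) = `|t| by rewrite enormZ z1 mulr1.
(* Two opposite points in the closure both lie in the cap, within [rho] of [x0], so their distance
   [2 * t] is less than [2 * rho]. *)
have [|l [sg [/andP[l0 lrho] sgE inOm out]]] := exit_time Om xb z rho sc Kxb z0.
  move=> t t0 Kp Km.
  have hp := nuP _ Kp; have hm := nuP _ Km.
  have sE : edot nu (xb + t *: z - x0) + edot nu (xb - t *: z - x0) =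
      2 * edot nu (xb - x0) by rewrite !(edotDr, edotNr); ring.
  have np : enorm (xb + t *: z - x0) < rho by apply: etaP => //; lra.
  have nm : enorm (xb - t *: z - x0) < rho by apply: etaP => //; lra.
  have := enormD_le (xb + t *: z - x0) (- (xb - t *: z - x0)).
  have -> : xb + t *: z - x0 + - (xb - t *: z - x0) = (2 * t) *: z.
    by apply/rowP => i; rewrite !mxE; ring.
  by rewrite enormN enz ger0_norm; lra.
pose o := odd_profile (B * edot nu z) (2 * c * sg) l r.
have rr : d <= r by lra.
have M20 : 0 <= M2 by rewrite /M2; lra.
have [ib bF] := tail_integral_ge R s d rho r l c M2 _ o s0 d0 drho rr (ltW c0) M20
  (measurable_odd_profile _ _ _ _) (odd_profileN _ _ _ _)
  (odd_profile_bounded _ _ _ _ l0).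
eexists; split; [exact: ib| |].
  by apply: le_trans bF; rewrite lee_fin.
move=> t _; set y := xb + t *: z; set w := ext_low _ _ _ _.
have wM2 : - M2 <= w - L xb.
  rewrite lerBrDr; apply: ext_low_ge => [|cy]; rewrite /M2.
    by have := LM xb; have := LM y; rewrite !ler_norml; lra.
  by have := LM xb; have := gG y cy; rewrite !ler_norml; lra.
have yx0 : `|t| < r -> enorm (y - x0) < 2 * r.
  move=> tr; have -> : y - x0 = t *: z + (xb - x0) by rewrite /y addrAC addrC.
  by have := enormD_le (t *: z) (xb - x0); rewrite enz; lra.
have wc : `|t| < r -> - c <= w - L xb.
  move=> /yx0 yr; rewrite lerBrDr; apply: ext_low_ge => [|cy].
    by have := Lnear y yr; lra.
  by have := gnear y cy yr; lra.
have wout : `|t| < r -> ~ closure Om y -> 3 * c <= w - L xb.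
  move=> /yx0 yr Ky; rewrite /w ext_low_out//.
  have nOy : ~ Om y by move/subset_closure.
  by have := gnear y (notOm y nOy) yr; lra.
apply: odd_profile_le => //; first by lra.
- move=> tl; rewrite /w ext_low_Om; last exact: inOm.
  have Ky : closure Om y by apply: subset_closure; exact: inOm.
  by have := xbmin y Ky; rewrite !aE /y edotDr edotZr; lra.
- move=> tr lt; apply: wout => //; have := out _ lt.
  by rewrite mulrA; case: sgE => ->; rewrite ?mulrNN mul1r mul1r.
Qed.

End core.

(** * Boundary values of sub- and supersolutions *)

Section pv.
Context {R : realType} {N : nat}.
Implicit Types (x z a : 'rV[R]_N).
Notation mu := (@lebesgue_measure R).

(** The increment is linear in [t], so each truncated integral already vanishes by oddness, before
    the limit is taken. *)
Lemma pv_edot (s d : R) a x z : 0 < s ->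
  lim ((fun eps : R => \int[mu]_(t in [set t : R | (eps < `|t| < d)%R])
     ((edot a (x + t *: z) - edot a x) * kern s t)%:E)%E @ 0^'+) = 0%E.
Proof.
move=> s0; apply: cvg_lim => //; apply: cvg_near_cst; near=> eps.
have eps0 : 0 < eps by near: eps; exact: nbhs_right_gt.
(* A bounded odd function that agrees with the linear increment on [|t| < d]. *)
pose o := odd_profile (edot a z) 0 d d.
have mD : measurable [set t : R | eps < `|t| < d].
  have -> : [set t : R | eps < `|t| < d] = [set t : R | `]eps, d[%classic `|t|].
    by apply/seteqP; split => t /=; rewrite in_itv.
  by apply: measurable_norm_preimage; exact: measurable_itv.
have [d0|d0] := leP d 0.
  rewrite (_ : [set t : R | _] = set0) ?integral_set0//.
  apply/seteqP; split => // t /=; have := normr_ge0 t; lra.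
transitivity (\int[mu]_(t in [set t : R | (eps < `|t| < d)%R])
    (o t * kern s t)%:E)%E.
  apply: eq_integral => t /[!inE] /= /andP[_ td].
  by rewrite edotDr edotZr addrAC subrr add0r /o odd_profile_small// [_ * t]mulrC.
apply: integral_odd => //.
- by move=> t /=; rewrite normrN.
- apply: measurable_funM; [exact: measurable_odd_profile|exact: measurable_kern].
- by move=> t; rewrite /o odd_profileN kernN mulNr.
apply: (@integrableS _ _ _ mu [set t : R | eps <= `|t|]) => //.
- exact: measurable_norm_ge.
- by move=> t /= /andP[/ltW].
apply: integrable_mul_kern => //; first exact: measurable_odd_profile.
by apply: odd_profile_bounded; exact: ltW.
Unshelve. all: by end_near. Qed.

Lemma Ez_edot_ge (s d F : R) (f w : 'rV[R]_N -> R) a x z (ux : R) (b : R -> R) :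
  0 < s ->
  (F%:E <= \int[mu]_(t in [set t | (d <= `|t|)%R]) (b t * kern s t)%:E)%E ->
  (forall t, d <= `|t| -> b t <= w (x + t *: z) - ux) ->
  ((F - f x)%:E <= Ez s f d z w (edot a) ux x)%E.
Proof.
move=> s0 Fb bw; rewrite /Ez pv_edot// add0e EFinB leeB//.
apply: le_trans Fb _; apply: le_integral_nonmeasurable => t dt.
by rewrite lee_fin ler_wpM2r ?kern_ge0// bw.
Qed.

Lemma Ez_edot_le (s d F : R) (f w : 'rV[R]_N -> R) a x z (ux : R) (b : R -> R) :
  0 < s ->
  mu.-integrable [set t | d <= `|t|] (fun t => (b t * kern s t)%:E) ->
  (F%:E <= \int[mu]_(t in [set t | (d <= `|t|)%R]) (b t * kern s t)%:E)%E ->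
  (forall t, d <= `|t| -> w (x + t *: z) - ux <= - b t) ->
  (Ez s f d z w (edot a) ux x <= (- F - f x)%:E)%E.
Proof.
move=> s0 ib Fb bw; rewrite /Ez pv_edot// add0e EFinB leeB//.
apply: (@le_trans _ _ (\int[mu]_(t in [set t | (d <= `|t|)%R])
    ((-1)%:E * (b t * kern s t)%:E))%E).
  apply: le_integral_nonmeasurable => t dt.
  by rewrite -EFinM lee_fin mulrA mulN1r ler_wpM2r ?kern_ge0// bw.
rewrite integralZl//; last exact: measurable_norm_ge.
by rewrite mulN1e EFinN leeN2.
Qed.

End pv.

Theorem theorem2p1 (R : realType) (N : nat) (s : R) (Om : set 'rV[R]_N)
    (f g u v : 'rV[R]_N -> R) :
  0 < s < 1 ->
  bounded_domain Om -> strictly_convex Om -> C2_domain Om ->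
  {within closure Om, continuous f} -> bounded_on f (closure Om) ->
  {within closure (~` Om), continuous g} -> bounded_on g (closure (~` Om)) ->
  visc_sub s Om f g u -> visc_super s Om f g v ->
  (forall x, boundary Om x -> u x <= g x) /\
  (forall x, boundary Om x -> g x <= v x).
Proof.
move=> /andP[s0 _] bd sc _ _ [Ff fF] cg [G gG].
move=> [[Mu uM] [ug subu]] [[Mv vM] [gv superv]].
split=> x0 bx0; rewrite leNgt; apply/negP => lt0.
(* The barrier is applied to [- u] and [- g]; negation exchanges the two envelopes and the two
   extensions. *)
- pose L := lsc_env (fun y => - u y).
  have NuM y : `|- u y| <= Mu by rewrite normrN; exact: uM.
  have UE y : usc_env u y = - L y by exact: usc_envN.
  have [||||||a [xb [d [d0 Kxb touch Lxb Hz]]]] :=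
    barrier s Mu G (Ff + 1) Om (fun y => - g y) L x0 s0 bd sc bx0.
  + exact: lsc_env_norm_le.
  + move=> x e e0; exact: (lsc_env_lsc _ Mu).
  + by move=> x; apply: continuousN; exact: cg.
  + by move=> x cx; rewrite normrN gG.
  + by move=> x Kx; have := ug x Kx; rewrite UE; lra.
  + by have := lsc_env_le _ Mu NuM x0; rewrite -/L; lra.
  (* The infimum has to be bounded above here, so a single direction suffices, but one must exist:
     the infimum over an empty sphere would be infinite. *)
  have [z z1] : exists z : 'rV[R]_N, sphere z.
    have [[y Oy] _] := bd.
    have xy : 0 < enorm (x0 - y).
      apply: enorm_gt0; rewrite subr_eq0; case: bx0 => _ nO.
      by apply: contra_notN nO => /eqP->.
    exists ((enorm (x0 - y))^-1 *: (x0 - y)).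
    by rewrite /sphere /= enormZ gtr0_norm ?invr_gt0// mulVf// gt_eqF.
  have [b [ib bF bw]] := Hz z z1.
  have [] := subu d (edot (- a)) xb d0 (C2_edot _).
    by move=> x xd; have := touch x xd; rewrite !UE !edotNl; lra.
  set E := Ed _ _ _ _ _ _ _; have E1 : (1%:E <= E)%E.
    rewrite /E /Ed leeNr -EFinN.
    apply: (@le_trans _ _ (Ez s f d z (ext_up Om (usc_env u) g) (edot (- a))
                              (usc_env u xb) xb)).
      by apply: ereal_inf_lbound; exists z.
    apply: le_trans (Ez_edot_le s d (Ff + 1) f _ (- a) xb z _ b s0 ib bF _) _.
      move=> t dt; have := bw t dt; rewrite ext_upN UE.
      have -> : (fun x => - usc_env u x) = L by apply/funext => y; rewrite UE opprK.
      by lra.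
    by rewrite lee_fin; have := fF xb Kxb; rewrite ler_norml; lra.
  move=> HOm Hbd; have E0 : (0 < E)%E by apply: lt_le_trans E1; rewrite lte_fin.
  have [Oxb|nOxb] := pselect (Om xb); first by have := HOm Oxb; rewrite leNgt E0.
  have bxb : boundary Om xb by split.
  have := Hbd bxb; rewrite ge_min leNgt E0 /= lee_fin UE.
  by have := Lxb bxb; lra.
- pose L := lsc_env v.
  have {}vM y : `|v y| <= Mv by exact: vM.
  have [||||||a [xb [d [d0 Kxb touch Lxb Hz]]]] :=
    barrier s Mv G (Ff + 1) Om g L x0 s0 bd sc bx0.
  + exact: lsc_env_norm_le.
  + move=> x e e0; exact: (lsc_env_lsc _ Mv).
  + exact: cg.
  + exact: gG.
  + exact: gv.
  + by have := lsc_env_le _ Mv vM x0; rewrite -/L; lra.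
  have [] := superv d (edot a) xb d0 (C2_edot _) touch.
  set E := Ed _ _ _ _ _ _ _; have E1 : (E <= (-1)%:E)%E.
    (* Here the infimum is bounded below, so the minorant is used in every direction; [F = Ff + 1]
       leaves [1] after subtracting [f xb]. *)
    rewrite /E /Ed leeNl -EFinN opprK; apply: le_ereal_inf_tmp => _ [z z1 <-].
    have [b [ib bF bw]] := Hz z z1.
    apply: le_trans (Ez_edot_ge s d (Ff + 1) f _ a xb z _ b s0 bF bw).
    by rewrite lee_fin; have := fF xb Kxb; rewrite ler_norml; lra.
  move=> HOm Hbd.
  have E0 : (E < 0)%E by apply: le_lt_trans E1 _; rewrite lte_fin; lra.
  have [Oxb|nOxb] := pselect (Om xb); first by have := HOm Oxb; rewrite leNgt E0.
  have bxb : boundary Om xb by split.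
  (* Both entries of the maximum are negative: the operator by the barrier estimate, [L xb - g xb]
     by the choice of [xb]. *)
  have := Hbd bxb; rewrite le_max leNgt E0 /= lee_fin.
  by have := Lxb bxb; rewrite -/L; lra.
Qed.
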